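(* Let $A_i=\frac12\sqrt{F_iF_{i+1}}$ for $i\ge1$. For every positive integer $n$, $$\left|\sum_{i=1}^n A_i-\frac{\sqrt{\varphi}}{2}\,(F_{n+2}-1)\right|\le\frac14 .$$
   Context: $F_n$ denotes the $n$-th Fibonacci number: $F_1=F_2=1$ and $F_{n+1}=F_n+F_{n-1}$ for $n\ge 2$. $\varphi=(1+\sqrt5)/2$. $A_i$ is the area of the $i$-th triangle of the Fibonacci--Theodorus spiral, i.e. of the right triangle with legs $\sqrt{F_i}$ and $\sqrt{F_{i+1}}$. *)

(* Defs.v *)
From mathcomp Require Import all_boot all_order all_algebra.
From mathcomp Require Import reals.

Set Implicit Arguments.
Unset Strict Implicit.
Unset Printing Implicit Defensive.

Import Order.TTheory GRing.Theory Num.Theory.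

Local Open Scope ring_scope.

(* Extended by [fib 0 = 0]; only indices [>= 1] matter. *)
Fixpoint fib (n : nat) : nat :=
  match n with
  | 0%N => 0%N
  | 1%N => 1%N
  | (m.+1 as k).+1 => (fib k + fib m)%N
  end.

Definition golden (R : realType) : R := (1 + Num.sqrt 5) / 2.

Definition triangle_area (R : realType) (i : nat) : R :=
  1 / 2 * Num.sqrt ((fib i)%:R * (fib i.+1)%:R).

(* Main.v *)
Require Import Defs.
From mathcomp Require Import all_boot all_order all_algebra.
From mathcomp Require Import reals.
From mathcomp Require Import ring lra.

(** Since [F_1 + ... + F_n = F_(n+2) - 1], the difference to bound is half the
    sum of the terms [sqrt (F_i F_(i+1)) - sqrt phi * F_i].  As
    [F_(i+1) - phi F_i = (-1/phi)^i], rationalizing each term gives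
    [(-1/phi)^i sqrt F_i / (sqrt F_(i+1) + sqrt phi sqrt F_i)], which alternates
    in sign and decreases in absolute value.  The sum is thus bounded by its
    first term [sqrt phi - 1 <= 1/2]. *)

Import Order.TTheory GRing.Theory Num.Theory.

Local Open Scope ring_scope.

(** Induction over all [e]: the sum is [e 0] minus the alternating sum of the shifted sequence,
    which lies between [0] and [e 1]. *)
Lemma alternating_sum_bounds (R : realDomainType) (e : nat -> R) (n : nat) :
  (forall i, 0 <= e i) -> (forall i, e i.+1 <= e i) ->
  0 <= \sum_(0 <= i < n) (-1) ^+ i * e i <= e 0%N.
Proof.
elim: n e => [|n IHn] e e_ge0 e_decr; first by rewrite big_nil lexx e_ge0.
have /andP[tail_ge0 tail_le] := IHn (fun i => e i.+1)
  (fun i => e_ge0 i.+1) (fun i => e_decr i.+1).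
rewrite big_nat_recl //= expr0 mul1r.
under eq_bigr => i _ do rewrite exprS mulN1r mulNr.
rewrite sumrN; have := e_decr 0%N; lra.
Qed.

Lemma fibSS (n : nat) : fib n.+2 = (fib n.+1 + fib n)%N.
Proof. by []. Qed.

Lemma fib_gt0 (n : nat) : (0 < fib n.+1)%N.
Proof. by elim: n => // n IHn; rewrite fibSS addn_gt0 IHn. Qed.

Lemma leq_fibS (n : nat) : (fib n <= fib n.+1)%N.
Proof. by case: n => // n; rewrite fibSS leq_addr. Qed.

Lemma fibSS_le_double (n : nat) : (fib n.+2 <= 2 * fib n.+1)%N.
Proof. by rewrite fibSS mul2n -addnn leq_add2l leq_fibS. Qed.

Lemma sum_fib (n : nat) : (\sum_(1 <= i < n.+1) fib i).+1 = fib n.+2.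
Proof.
elim: n => [|n IHn]; first by rewrite big_nil.
by rewrite big_nat_recr //= -addSn IHn.
Qed.

Section Golden.
Variable R : realType.
Local Notation phi := (golden R).
Local Notation s := (Num.sqrt phi).
Local Notation g := (phi - 1).
Local Notation F i := ((fib i)%:R : R).
Local Notation x i := (Num.sqrt (F i)).

Lemma golden_sqr : phi ^+ 2 = phi + 1.
Proof.
have h5 : Num.sqrt 5 ^+ 2 = 5 :> R by rewrite sqr_sqrtr ?ler0n.
by rewrite /golden; field: h5.
Qed.

(** The upper bound is tight enough for [g ^+ 2 <= 1 / 2], as [(7 / 10) ^+ 2 = 49 / 100]. *)
Lemma golden_bounds : 3 / 2 <= phi <= 17 / 10.
Proof.
have h5 : Num.sqrt 5 ^+ 2 = 5 :> R by rewrite sqr_sqrtr ?ler0n.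
have h0 := sqrtr_ge0 (5 : R).
by rewrite /golden; apply/andP; split; nra.
Qed.

(** By [golden_sqr], [g * phi = 1], so each step multiplies the left side by [- g], the conjugate
    root of [X ^+ 2 = X + 1]. *)
Lemma fib_sub_golden (i : nat) : F i.+1 - phi * F i = (- g) ^+ i.
Proof.
elim: i => [|i IHi]; first by rewrite expr0 /=; ring.
rewrite exprS -IHi fibSS natrD; ring: golden_sqr.
Qed.

(* The absolute value of [sqrt (F_(j+1) F_(j+2)) - sqrt phi * F_(j+1)]. *)
Definition fib_error (j : nat) : R :=
  g ^+ j.+1 * (x j.+1 / (x j.+2 + s * x j.+1)).

Lemma sqrt_fib_gt0 (i : nat) : 0 < x i.+1.
Proof. by rewrite sqrtr_gt0 ltr0n fib_gt0. Qed.

Lemma sqrt_golden_gt0 : 0 < s.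
Proof. by rewrite sqrtr_gt0; have := golden_bounds; lra. Qed.

Lemma fib_error_den_gt0 (j : nat) : 0 < x j.+2 + s * x j.+1.
Proof. by rewrite addr_gt0 ?mulr_gt0 ?sqrt_fib_gt0 ?sqrt_golden_gt0. Qed.

Lemma fib_error_ge0 (j : nat) : 0 <= fib_error j.
Proof.
rewrite mulr_ge0 ?divr_ge0 ?exprn_ge0 ?(ltW (sqrt_fib_gt0 _)) //.
  by have := golden_bounds; lra.
exact: ltW (fib_error_den_gt0 j).
Qed.

Lemma fib_error_decr (j : nat) : fib_error j.+1 <= fib_error j.
Proof.
have hg := golden_bounds.
have g_ge0 : 0 <= g by lra.
rewrite /fib_error exprSr -mulrA ler_wpM2l ?exprn_ge0 // mulrA.
rewrite ler_pdivrMr ?fib_error_den_gt0 // mulrAC ler_pdivlMr ?fib_error_den_gt0 //.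
(* With denominators cleared and products expanded, the two terms on the left are each bounded by
   one on the right. *)
have s_gt0 := sqrt_golden_gt0.
have x1_gt0 := sqrt_fib_gt0 j; have x2_gt0 := sqrt_fib_gt0 j.+1.
have x1_ge0 := ltW x1_gt0; have x2_ge0 := ltW x2_gt0.
have x2_le_x3 : x j.+2 <= x j.+3 by rewrite ler_wsqrtr // ler_nat leq_fibS.
have gx2_le_x1 : g * x j.+2 <= x j.+1.
  rewrite -ler_sqr ?nnegrE ?mulr_ge0 // exprMn !sqr_sqrtr ?ler0n //.
  have : F j.+2 <= 2 * F j.+1 by rewrite -natrM ler_nat fibSS_le_double.
  have : 0 <= F j.+2 by rewrite ler0n.
  have : g ^+ 2 <= 1 / 2 by nra.
  nra.
have : g * x j.+2 * x j.+2 <= x j.+1 * x j.+3.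
  by rewrite ler_pM ?mulr_ge0.
have : g * (s * x j.+1 * x j.+2) <= s * x j.+1 * x j.+2.
  by rewrite ler_piMl ?mulr_ge0 ?(ltW s_gt0) //; lra.
lra.
Qed.

Lemma fib_error0_le : fib_error 0 <= 1 / 2.
Proof.
have hg := golden_bounds; have s_gt0 := sqrt_golden_gt0.
rewrite /fib_error expr1 /= sqrtr1 mulr1 mulrA mulr1 ler_pdivrMr; last lra.
(* As [g = (s - 1) * (s + 1)], the goal amounts to [s <= 3 / 2], that is [phi <= 9 / 4]. *)
have : s ^+ 2 = phi by rewrite sqr_sqrtr //; lra.
nra.
Qed.

Lemma triangle_area_sub (j : nat) :
  triangle_area R j.+1 - s / 2 * F j.+1 = - (1 / 2) * ((-1) ^+ j * fib_error j).
Proof.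
have den0 : x j.+2 + s * x j.+1 != 0 by rewrite gt_eqF ?fib_error_den_gt0.
have hs : s ^+ 2 = phi by rewrite sqr_sqrtr //; have := golden_bounds; lra.
have hx i : F i = x i ^+ 2 by rewrite sqr_sqrtr ?ler0n.
have -> : (-1) ^+ j * fib_error j
    = - ((- g) ^+ j.+1 * (x j.+1 / (x j.+2 + s * x j.+1))).
  by rewrite /fib_error [(- g) ^+ _]exprNn [(-1) ^+ j.+1]exprS mulN1r !mulNr opprK mulrA.
rewrite -fib_sub_golden /triangle_area sqrtrM ?ler0n //.
(* Once the roots are variables, [phi] and the Fibonacci numbers can be replaced by squares without
   touching the radicands; a rational identity remains. *)
move: hs den0 (hx j.+1) (hx j.+2).
move: s (x j.+1) (x j.+2) => t a b <- den0 -> ->.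
by field.
Qed.

End Golden.

Theorem theorem2p4 (R : realType) (n : nat) (n_gt0 : (0 < n)%N) :
  `| \sum_(1 <= i < n.+1) triangle_area R i
     - Num.sqrt (golden R) / 2 * ((fib n.+2)%:R - 1) | <= 1 / 4.
Proof.
rewrite -sum_fib -[X in X - 1]natr1 addrK natr_sum mulr_sumr -sumrB big_add1 /=.
under eq_bigr => i _ do rewrite triangle_area_sub.
rewrite -mulr_sumr.
(* The alternating sum lies in [[0, 1/2]], and the factor [- (1 / 2)] sends it into [[-1/4, 0]]. *)
have := alternating_sum_bounds _ _ n (fib_error_ge0 R) (fib_error_decr R).
have := fib_error0_le R.
by rewrite ler_norml; lra.
Qed.
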